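(* Let $a, b, c, d$ be positive real numbers with $a < b < c < d$. Then there exists a unique $p \in \mathbb{R}$ such that $a : b ::^p c : d$.
   Context: For positive real numbers $x, y$ and $p \in \mathbb{R}$, the generalized mean in $p$ is $m_p(x,y) = \lim_{r \to p} \left(\tfrac12 (x^r + y^r)\right)^{1/r}$ (limit over real $r \neq 0$). Thus $m_p(x,y) = \left(\tfrac12 (x^p+y^p)\right)^{1/p}$ for $p \neq 0$, and $m_0(x,y) = \sqrt{xy}$. Four positive real numbers $a,b,c,d$ (in this order) are in analogy in power $p$, written $a : b ::^p c : d$, if and only if $m_p(a,d) = m_p(b,c)$. *)

(* Defs.v *)
From HB Require Import structures.
From mathcomp Require Import all_boot all_order all_algebra.
From mathcomp Require Import all_classical all_reals all_analysis.
Set Implicit Arguments.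
Unset Strict Implicit.
Unset Printing Implicit Defensive.
Import Order.TTheory GRing.Theory Num.Theory.
Import numFieldNormedType.Exports.
Local Open Scope classical_set_scope.
Local Open Scope ring_scope.

(* The limit is taken over the reals r != 0 tending to p, so that one formula
   covers p = 0 (where the limit is the geometric mean) and p != 0 alike. The
   means are those of positive x and y; powR is total and only has its usual
   meaning on positive bases. *)
Definition gmean (R : realType) (p x y : R) : R :=
  lim (((x `^ r + y `^ r) / 2) `^ r^-1
         @[r --> within [set r : R | r != 0] (nbhs p)]).

Definition analogy (R : realType) (p a b c d : R) : Prop :=
  gmean p a d = gmean p b c.

(* Main.v *)
(* Taking logarithms of a, b, c, d, the equality of means at p <> 0 says that
   e^(pa) + e^(pd) - e^(pb) - e^(pc) vanishes. Dividing by p e^(pb) gives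
     e^(p(c-b)) (e^(p(d-c)) - 1)/p - (1 - e^(-p(b-a)))/p,
   which extends continuously to p = 0, where its value d - c - (b - a) vanishes
   exactly when the geometric means agree. Since x |-> (e^x - 1)/x is positive
   and nondecreasing, this function of p is strictly increasing, and the bound
   1 + x <= e^x exhibits points where it is nonnegative and nonpositive. *)
Require Import Defs.
From HB Require Import structures.
From mathcomp Require Import all_boot all_order all_algebra.
From mathcomp Require Import all_classical all_reals all_analysis.
From mathcomp Require Import ring lra.
Set Implicit Arguments.
Unset Strict Implicit.
Unset Printing Implicit Defensive.
Import Order.TTheory GRing.Theory Num.Theory.
Import numFieldNormedType.Exports.
Local Open Scope ring_scope.

(** * Difference quotient of the exponential at 0 *)

(** The value 1 at 0 is the derivative of [expR] there and makes the quotient continuous; the bare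
    formula would give 0, since division by 0 returns 0. *)
Definition expR_slope {R : realType} (x : R) : R :=
  if x == 0 then 1 else (expR x - 1) / x.

Lemma mul_expR_slope {R : realType} (x : R) : x * expR_slope x = expR x - 1.
Proof.
rewrite /expR_slope; case: eqVneq => [->|x0];
  last by rewrite mulrCA divff ?mulr1.
by rewrite expR0 subrr mul0r.
Qed.

(** Factoring out [expR x] leaves [1 + t <= expR t] at [t = y - x]. This is the form in which
    convexity of the exponential is used. *)
Lemma expR_tangent {R : realType} (x y : R) :
  expR x * (1 + (y - x)) <= expR y.
Proof.
have -> : expR y = expR x * expR (y - x) by rewrite -expRD; congr expR; ring.
by rewrite ler_pM2l ?expR_gt0// expR_ge1Dx.
Qed.

Lemma expR_slope_ge1 {R : realType} (x : R) : 0 <= x -> 1 <= expR_slope x.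
Proof.
rewrite le_eqVlt => /orP[/eqP<-|x0]; first by rewrite /expR_slope eqxx.
rewrite -(ler_pM2l x0) mul_expR_slope; have := expR_ge1Dx x; lra.
Qed.

Lemma expR_slope_le1 {R : realType} (x : R) : x <= 0 -> expR_slope x <= 1.
Proof.
rewrite le_eqVlt => /orP[/eqP->|x0]; first by rewrite /expR_slope eqxx.
rewrite -(ler_nM2l x0) mul_expR_slope; have := expR_ge1Dx x; lra.
Qed.

Lemma expR_slope_gt0 {R : realType} (x : R) : 0 < expR_slope x.
Proof.
have [x0|x0] := leP 0 x; first exact: lt_le_trans ltr01 (expR_slope_ge1 x0).
rewrite -(ltr_nM2l x0) mul_expR_slope mulr0 subr_lt0.
by rewrite -expR0 ltr_expR.
Qed.

(** By convexity, chords of the exponential from the point over 0 steepen to the right. When [x] and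
    [y] have the same sign, multiplying by [x * y > 0] clears the denominators. *)
Lemma expR_slope_homo {R : realType} :
  {homo @expR_slope R : x y / x <= y}.
Proof.
move=> x y xy; have [x0|x0] := leP x 0; last first.
  have y0 : 0 < y by exact: lt_le_trans xy.
  rewrite -(ler_pM2l (mulr_gt0 x0 y0)).
  have -> : x * y * expR_slope x = y * (x * expR_slope x) by ring.
  have -> : x * y * expR_slope y = x * (y * expR_slope y) by ring.
  rewrite !mul_expR_slope.
  (* Here [x] lies between 0 and [y]: the tangent at [x], taken at [y] and at 0 with weights [x] and
     [y - x], sums to [y * expR x] because the terms in [x * (y - x)] cancel. *)
  have h1 := expR_tangent x y; have h2 := expR_tangent x 0.
  rewrite expR0 in h2.
  have h3 : x * (expR x * (1 + (y - x))) <= x * expR y by rewrite ler_pM2l.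
  have h4 : (y - x) * (expR x * (1 + (0 - x))) <= (y - x) * 1.
    by rewrite ler_wpM2l// subr_ge0.
  lra.
have [y0|y0] := leP 0 y.
  exact: le_trans (expR_slope_le1 x0) (expR_slope_ge1 y0).
have {}x0 : x < 0 by exact: le_lt_trans y0.
have xy0 : 0 < x * y by rewrite nmulr_lgt0.
rewrite -(ler_pM2l xy0).
have -> : x * y * expR_slope x = y * (x * expR_slope x) by ring.
have -> : x * y * expR_slope y = x * (y * expR_slope y) by ring.
rewrite !mul_expR_slope.
(* Mirror image: [y] lies between [x] and 0, so the tangent is taken at [y], with weights [- y] and
   [y - x]. *)
have h1 := expR_tangent y x; have h2 := expR_tangent y 0.
rewrite expR0 in h2.
have h3 : - y * (expR y * (1 + (x - y))) <= - y * expR x.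
  by rewrite ler_pM2l// oppr_gt0.
have h4 : (y - x) * (expR y * (1 + (0 - y))) <= (y - x) * 1.
  by rewrite ler_wpM2l// subr_ge0.
lra.
Qed.

Lemma is_derive0_cvg {R : realType} (f : R -> R) (df : R) :
  is_derive (0 : R) 1 f df -> (h^-1 * (f h - f 0) @[h --> 0^'] --> df)%classic.
Proof.
move=> [dvf <-]; apply: cvg_trans dvf; apply: near_eq_cvg.
by apply: nearW => h /=; rewrite addr0 [h *: 1]mulr1.
Qed.

Lemma nbhs_neq {R : realType} (x y : R) : x != y -> \forall z \near x, z != y.
Proof. by move=> xy; apply: open_nbhs_nbhs; split; [exact: open_neq|]. Qed.

Lemma continuous_expR_slope {R : realType} : continuous (@expR_slope R).
Proof.
move=> /= x; have [->|x0] := eqVneq x 0; last first.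
  have cquo : ((expR y - 1) / y @[y --> x] --> (expR x - 1) / x)%classic.
    apply: cvgM; last by apply: cvgV => //; exact: cvg_id.
    by apply: cvgB; [exact: continuous_expR|exact: cvg_cst].
  have xE : expR_slope x = (expR x - 1) / x.
    by rewrite {1}/expR_slope (negbTE x0).
  rewrite /continuous_at xE.
  apply: cvg_trans cquo; apply: near_eq_cvg; near=> y.
  rewrite /expR_slope ifF//; apply/negbTE; near: y.
  exact: nbhs_neq.
apply/continuous_withinNx.
(* The value 1 is rewritten as [expR 0], the derivative of [expR] at 0, so that the punctured limit
   is the one defining that derivative. *)
rewrite {2}/expR_slope eqxx -expR0.
apply: cvg_trans (is_derive0_cvg (is_derive_expR 0)); apply: near_eq_cvg.
near=> h; rewrite /expR_slope expR0 mulrC ifF//; apply/negbTE; near: h.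
exact: nbhs_dnbhs_neq.
Unshelve. all: by end_near. Qed.

(** * Closed forms of the generalized means *)

(** The expression is continuous in the exponent at [p], and removing 0 does not change the
    neighbourhood filter of a nonzero point. *)
Lemma gmean_neq0 {R : realType} (p x y : R) : p != 0 -> 0 < x -> 0 < y ->
  gmean p x y = ((x `^ p + y `^ p) / 2) `^ p^-1.
Proof.
move=> p0 x0 y0; rewrite /gmean.
have m0 r : 0 < (x `^ r + y `^ r) / 2 by rewrite divr_gt0// addr_gt0 ?powR_gt0.
have powRE (r z : R) : 0 < z -> z `^ r = expR (r * ln z).
  by move=> z0; rewrite /powR gt_eqF.
have cpow z : 0 < z -> (z `^ r @[r --> p] --> z `^ p)%classic.
  move=> z0; rewrite powRE//.
  under eq_fun do rewrite powRE//.
  apply: continuous_cvg; first exact: continuous_expR.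
  by apply: cvgM; [exact: cvg_id|exact: cvg_cst].
have cf : (((x `^ r + y `^ r) / 2) `^ r^-1 @[r --> p] -->
    ((x `^ p + y `^ p) / 2) `^ p^-1)%classic.
  rewrite powRE//; under eq_fun do rewrite powRE//.
  apply: continuous_cvg; first exact: continuous_expR.
  apply: cvgM; first by apply: cvgV => //; exact: cvg_id.
  apply: continuous_cvg; first exact: continuous_ln.
  by apply: cvgM; [apply: cvgD; exact: cpow|exact: cvg_cst].
have -> : within [set r : R | r != 0]%classic (nbhs p) = nbhs p.
  apply/seteqP; split => U; last by apply: filterS.
  have pn0 : \forall r \near p, r != 0 by exact: nbhs_neq.
  by move=> wU; apply: filterS2 pn0 wU => r r0; apply.
exact: cvg_lim.
Qed.

(** The logarithm of the mean of exponent [r] is [L r / r] with [L 0 = 0], so its limit at 0 is the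
    derivative of [L] there; the result is the geometric mean. *)
Lemma gmean0 {R : realType} (x y : R) : 0 < x -> 0 < y ->
  gmean 0 x y = expR ((ln x + ln y) / 2).
Proof.
move=> x0 y0; rewrite /gmean; apply: (@cvg_lim _ _ _ (dnbhs (0 : R))) => //.
pose L r : R := ln ((expR (r * ln x) + expR (r * ln y)) / 2).
have L0 : L 0 = 0 by rewrite /L !mul0r expR0 divff ?ln1.
have dL : is_derive (0 : R) 1 L ((ln x + ln y) / 2).
  have dE z : is_derive (0 : R) 1 (fun r => expR (r * z)) z.
    have dM : is_derive (0 : R) 1 (fun r : R => r * z) z.
      have := is_deriveZ z (is_derive_id (0 : R) 1).
      rewrite [z *: 1]mulr1; congr is_derive.
      by apply/funext => r; rewrite mulrC.
    have := @is_derive1_comp R expR ( *%R^~ z) 0 _ _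
      (is_derive_expR (0 * z)) dM.
    by rewrite mul0r expR0 mul1r.
  have dS : is_derive (0 : R) 1
      (fun r => (expR (r * ln x) + expR (r * ln y)) / 2) ((ln x + ln y) / 2).
    have := is_deriveZ 2^-1 (is_deriveD (dE (ln x)) (dE (ln y))).
    rewrite [_ *: _]mulrC; congr is_derive.
    by apply/funext => r /=; rewrite [_ *: _]mulrC.
  have dln := @is_derive1_ln R 1 ltr01.
  have := @is_derive1_comp R (@ln R)
    (fun r => (expR (r * ln x) + expR (r * ln y)) / 2) 0 _ _ _ dS.
  by rewrite !mul0r expR0 divff// => /(_ _ dln); rewrite invr1 mul1r.
have cL : (expR (h^-1 * (L h - L 0)) @[h --> 0^'] -->
    expR ((ln x + ln y) / 2))%classic.
  apply: continuous_cvg; first exact: continuous_expR.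
  exact: is_derive0_cvg.
apply: cvg_trans cL; apply: near_eq_cvg; apply: nearW => h.
rewrite L0 subr0 /L /powR !gt_eqF//.
by rewrite divr_gt0// addr_gt0 ?expR_gt0.
Qed.

(** * The defect function: continuity, monotonicity, a zero *)

(* Here [a], [b], [c], [d] stand for the logarithms of the four numbers. *)
Definition analogy_defect {R : realType} (a b c d p : R) : R :=
  expR (p * (c - b)) * ((d - c) * expR_slope (p * (d - c))) -
  (b - a) * expR_slope (- (p * (b - a))).

Lemma continuous_analogy_defect {R : realType} (a b c d : R) :
  continuous (analogy_defect a b c d).
Proof.
move=> p; rewrite /analogy_defect.
have cl k : (r * k @[r --> p] --> p * k)%classic.
  by apply: cvgM; [exact: cvg_id|exact: cvg_cst].
apply: cvgB.
  apply: cvgM; first by apply: continuous_cvg => //; exact: continuous_expR.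
  apply: cvgM; first exact: cvg_cst.
  by apply: continuous_cvg => //; exact: continuous_expR_slope.
apply: cvgM; first exact: cvg_cst.
apply: continuous_cvg; first exact: continuous_expR_slope.
exact: cvgN.
Qed.

(** Strictness comes from the factor [expR (p * (c - b))]; the slope factors contribute only weak
    monotonicity, the subtracted one decreasing through the sign of its argument. *)
Lemma analogy_defect_homo {R : realType} (a b c d : R) :
    a < b -> b < c -> c < d ->
  {homo analogy_defect a b c d : p q / p < q}.
Proof.
move=> ab bc cd p q pq; rewrite /analogy_defect ltr_leB//.
  have dc : 0 < d - c by rewrite subr_gt0.
  apply: (@lt_le_trans _ _
    (expR (q * (c - b)) * ((d - c) * expR_slope (p * (d - c))))).
    by rewrite ltr_pM2r ?mulr_gt0 ?expR_slope_gt0// ltr_expR ltr_pM2r//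
      subr_gt0.
  rewrite ler_pM2l ?expR_gt0// ler_pM2l// expR_slope_homo//.
  by rewrite ler_pM2r// ltW.
rewrite ler_pM2l ?subr_gt0// expR_slope_homo// lerN2.
by rewrite ler_pM2r ?subr_gt0// ltW.
Qed.

Lemma analogy_defect_root {R : realType} (a b c d : R) :
    a < b -> b < c -> c < d ->
  exists p, analogy_defect a b c d p = 0.
Proof.
move=> ab bc cd; set f := analogy_defect a b c d.
have u0 : 0 < b - a by rewrite subr_gt0.
have v0 : 0 < c - b by rewrite subr_gt0.
have s0 : 0 < d - c by rewrite subr_gt0.
(* Bounding both slopes by 1 and the exponential by its tangent, [q] is chosen to make
   [(1 + q * (c - b)) * (d - c)] equal to [(d - c) + (b - a)]; [r] does the same for
   [(1 - r * (c - b)) * (b - a)]. *)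
pose q := (b - a) / ((d - c) * (c - b)).
pose r := - ((d - c) / ((b - a) * (c - b))).
have q0 : 0 < q by rewrite divr_gt0// mulr_gt0.
have r0 : r < 0 by rewrite oppr_lt0 divr_gt0// mulr_gt0.
have fq : 0 <= f q.
  rewrite /f /analogy_defect subr_ge0.
  apply: (@le_trans _ _ (b - a)).
    by rewrite ger_pMr// expR_slope_le1// oppr_le0 mulr_ge0// ltW.
  apply: (@le_trans _ _ ((1 + q * (c - b)) * (d - c))).
    have -> : (1 + q * (c - b)) * (d - c) = (d - c) + (b - a).
      by rewrite /q; field; rewrite !gt_eqF.
    by rewrite lerDr ltW.
  have qv0 : 0 <= q * (c - b) by rewrite mulr_ge0// ltW.
  apply: ler_pM; rewrite ?expR_ge1Dx ?(ltW s0)// ?addr_ge0//.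
  by rewrite ler_pMr// expR_slope_ge1// mulr_ge0// ltW.
have fr : f r <= 0.
  rewrite /f /analogy_defect subr_le0.
  apply: (@le_trans _ _ (b - a)); last first.
    by rewrite ler_pMr// expR_slope_ge1// oppr_ge0 nmulr_rle0// ltW.
  apply: (@le_trans _ _ (expR (r * (c - b)) * (d - c))).
    rewrite ler_pM2l ?expR_gt0// ger_pMr// expR_slope_le1//.
    by rewrite nmulr_rle0// ltW.
  (* Moving the exponential across turns the upper bound needed for it into a lower bound for its
     inverse, which the tangent supplies. *)
  rewrite -(ler_pM2l (expR_gt0 (- (r * (c - b))))) mulrA -expRD.
  rewrite addNr expR0 mul1r.
  apply: (@le_trans _ _ ((1 - r * (c - b)) * (b - a))); last first.
    by rewrite ler_pM2r// expR_ge1Dx.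
  have -> : (1 - r * (c - b)) * (b - a) = (b - a) + (d - c).
    by rewrite /r; field; rewrite !gt_eqF.
  by rewrite lerDr ltW.
have rq : r <= q by exact: ltW (lt_trans r0 q0).
have [||p _ fp] := @IVT R f r q 0 rq; last by exists p.
  by apply: continuous_subspaceT => x; exact: continuous_analogy_defect.
by rewrite ge_min fr /= le_max fq orbT.
Qed.

(** * Analogy as vanishing of the defect *)

Lemma analogyP {R : realType} (a b c d p : R) :
    0 < a -> 0 < b -> 0 < c -> 0 < d ->
  analogy p a b c d <-> analogy_defect (ln a) (ln b) (ln c) (ln d) p = 0.
Proof.
move=> a0 b0 c0 d0; rewrite /analogy.
have [->|p0] := eqVneq p 0.
  rewrite !gmean0// /analogy_defect !mul0r oppr0 expR0 /expR_slope eqxx.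
  split => [/expR_inj|]; first lra.
  by move=> h; congr (expR (_ / 2)); lra.
have m0 (x y : R) : 0 < x -> 0 < y -> 0 < (x `^ p + y `^ p) / 2.
  by move=> x0 y0; rewrite divr_gt0// addr_gt0 ?powR_gt0.
set A := ln a; set B := ln b; set C := ln c; set D := ln d.
(* The factor [p] completes each slope to [x * expR_slope x], which is [expR x - 1]; the two
   constants left, times [expR (p * B)], give the terms of [b] and [c]. *)
have key : p * expR (p * B) * analogy_defect A B C D p =
    (a `^ p + d `^ p) - (b `^ p + c `^ p).
  have -> : p * expR (p * B) * analogy_defect A B C D p =
    expR (p * B) * (expR (p * (C - B)) *
       (p * (D - C) * expR_slope (p * (D - C))) +
       (- (p * (B - A)) * expR_slope (- (p * (B - A))))).
    by rewrite /analogy_defect; ring.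
  rewrite !mul_expR_slope mulrDr mulrA !mulrBr !mulr1 -!expRD.
  rewrite /powR !gt_eqF//.
  have -> : p * B + (p * C - p * B) = p * C by ring.
  have -> : p * C + (p * D - p * C) = p * D by ring.
  have -> : p * B + - (p * B - p * A) = p * A by ring.
  rewrite -/A -/B -/C -/D; ring.
have pB0 : p * expR (p * B) != 0 by rewrite mulf_neq0// gt_eqF// expR_gt0.
have -> : analogy_defect A B C D p = 0 <-> a `^ p + d `^ p = b `^ p + c `^ p.
  split=> [h|h]; first by move: key; rewrite h mulr0 => /esym/subr0_eq.
  by apply: (mulfI pB0); rewrite key h subrr mulr0.
(* Raising to the power [p] undoes the outer root, so equal means have equal power sums. *)
have mK x y : 0 < x -> 0 < y ->
    ((x `^ p + y `^ p) / 2) `^ p^-1 `^ p = (x `^ p + y `^ p) / 2.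
  by move=> x0 y0; rewrite -powRrM (mulVf p0) powRr1// ltW// m0.
rewrite (gmean_neq0 p0 a0 d0) (gmean_neq0 p0 b0 c0); split => [|->] //.
move=> /(congr1 (@powR R ^~ p)); rewrite (mK _ _ a0 d0) (mK _ _ b0 c0).
by apply: mulIf; rewrite invr_neq0.
Qed.

Theorem theorem6 (R : realType) (a b c d : R)
  (ha : 0 < a) (hb : 0 < b) (hc : 0 < c) (hd : 0 < d)
  (hab : a < b) (hbc : b < c) (hcd : c < d) :
  exists! p : R, analogy p a b c d.
Proof.
have lab : ln a < ln b by rewrite ltr_ln.
have lbc : ln b < ln c by rewrite ltr_ln.
have lcd : ln c < ln d by rewrite ltr_ln.
have [p fp] := analogy_defect_root lab lbc lcd.
exists p; split; first exact/analogyP.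
move=> q /analogyP => /(_ ha hb hc hd) fq.
by apply: (inc_inj (le_mono (analogy_defect_homo lab lbc lcd))); rewrite fp fq.
Qed.
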